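(* Let $n\ge4$ be fixed, let $r\ge1$, put $m=r+1$, and let $p>2n$ be a prime with $m\mid p-1$. Given a primitive $m$th root of unity in $\mathbb F_p$, the optimized World Cup calculation of $D_n(r)\bmod p$ described in the context (precomputed tables, residual evaluations and class sums together) uses $$O_n\bigl(m^{n-4}+m^4\bigr)$$ field operations in $\mathbb F_p$. This bound includes both the residual evaluations and the class sums. It is not a polynomial bound in the variable $n$.
   Context: $D_n(r)$ is the number of $n\times n$ nonnegative integer matrices with all diagonal entries $0$ and all row and column sums equal to $r$. Additions, multiplications and divisions in $\mathbb F_p$ each count as one field operation. Integer bookkeeping (root-index arithmetic modulo $m$, generation of multiplicity patterns, scheduling) is counted separately. The constant in $O_n$ may depend on $n$. **Notation.** $\Omega=\{a\in\mathbb F_p:a^m=1\}$. For a multiset $M$ of $n$ elements of $\Omega$, $\mu_a$ is the multiplicity of $a$, $\mathrm{mult}(M)=n!/\prod_a\mu_a!$, and $\eta(M)$ is the number of roots of maximal multiplicity in $M$. $\mathcal M_{\max}$ is the set of such $M$ in which $1$ has maximal multiplicity and this multiplicity is at least $2$. With $h_k$ the complete homogeneous symmetric polynomial of degree $k$, put $\Theta_0(M)=\prod_a a^{\mu_a}\prod_a(h_r(M)-a\,h_{r-1}(M))^{\mu_a}$. The calculation evaluates the identity $D_n(r)=m^{1-n}\sum_{M\in\mathcal M_{\max}}\frac{\mathrm{mult}(M)}{\eta(M)}\Theta_0(M)$ in $\mathbb F_p$. The pattern of $M$ is the unordered list of its multiplicities that are at least $2$; the remaining elements are distinct singletons. Let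 $\mathcal G_0=\{(2),(3),(2,2),(3,2),(2,2,2),(2,2,2,2)\}$; patterns that are impossible for $n,m$ are omitted. **The optimized World Cup calculation** consists of the following. (1) *Tables.* Inverses of all differences of distinct elements of $\Omega$, factorials, and, for $c\in\Omega\setminus\{1\}$, the powers $(1-c)^{-\mu}$ for the multiplicities $\mu\le n$ needed and the values $C_j(c/(1-c))$ with their needed multiples, $1\le j\le n-2$. Here $C_j(y)=\frac1{j!}\sum_{v=1}^j(v-1)!\,S(j,v)y^v$ and $S(j,v)$ is the Stirling number of the second kind. (2) *Residual evaluations.* Every $M\in\mathcal M_{\max}$ whose pattern is not in $\mathcal G_0$ is evaluated individually. For each repeated root $a$ (that is, $\mu_a\ge2$) put $C_a=(-1)^{\mu_a}\frac ma\prod_{b\ne a}(1-b/a)^{-\mu_b}$ and $\ell_{a,j}=-r\,\mathbf 1_{j=1}+(\mu_a-m^j)\beta_j+\sum_{b\neq a}\mu_bC_j\bigl(\tfrac{b/a}{1-b/a}\bigr)$, where $\log\frac{s}{e^s-1}=\sum_{j\ge1}\beta_js^j$, and compute $f_{a,0}=1$, $f_{a,j}=\frac1j\sum_{i=1}^ji\,\ell_{a,i}f_{a,j-i}$ for $j\le\mu_a-2$. Then $h_r(M)=\sum_{\mu_a\ge2}C_af_{a,\mu_a-2}$ and $h_{r-1}(M)=\sum_{\mu_a\ge2}\frac{C_a}{a}\sum_{j=0}^{\mu_a-2}\frac{f_{a,j}}{(\mu_a-2-j)!}$, sharing the same coefficients $f_{a,j}$, and $\mathrm{mult}(M)\Theta_0(M)/\eta(M)$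 is added to a sum $S$. The multisets are traversed by assigning roots successively to the parts of the pattern, repeated parts first; the products in $C_a$ and the numbers $j\ell_{a,j}$ are cached and updated along shared partial assignments. (3) *Class sums.* For the patterns in $\mathcal G_0$ the choices of singleton roots are summed together. Pattern $(2)$ contributes $0$. For each other pattern with $t$ parts, $R$ runs over the $t$-subsets of $\Omega$ containing $1$. If all parts are $2$, then $\mu_a=2$ for $a\in R$ and $\eta=t$; for $(3)$ and $(3,2)$, $\mu_1=3$, $\mu_a=2$ for $a\in\mathcal D=R\setminus\{1\}$, and $\eta=1$. Put $k=n-\sum_{a\in R}\mu_a$. For all-double patterns put $\tilde q_a=a^{n-4}\prod_{b\in R\setminus\{a\}}(a-b)^{-2}$ and $P_{a,x}=a-x$, with no variable $Z$. For $(3)$ and $(3,2)$ put $\tilde q_1=\prod_{b\in\mathcal D}(1-b)^{-2}$, $\tilde q_b=b^{n-4}(b-1)^{-3}$ for $b\in\mathcal D$, $c_0=\frac{m+2n-7}2-2\sum_{b\in\mathcal D}(1-b)^{-1}$, $P_{1,x}(Z)=1+(1-x)Z$ and $P_{b,x}(Z)=b-x$ for $b\in\mathcal D$. With variables $\mathbf Y=(Y_a)_{a\in R}$ let $\mathcal P_R=\prod_{b\in R}\bigl(\sum_{a\in R}P_{a,b}Y_a\bigr)^{\mu_b}$, and for $\mathbf e\in\mathbb Z_{\ge0}^R$ with $|\mathbf e|=\sum_{a\in R}e_a=n$ let $w_s(\mathbf e)=s\prod_{a\in R}(a-s)^{-e_a}$. In the all-double case $$\Psi_R(\mathbf e)=[v^k\mathbf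 Y^{\mathbf e}]\,\mathcal P_R\prod_{s\in\Omega\setminus R}\Bigl(1+v\,w_s(\mathbf e)\sum_{a\in R}(a-s)Y_a\Bigr),$$ and for $(3)$ and $(3,2)$ $$\Psi_R(\mathbf e)=\mathcal L_{c_0}[v^k\mathbf Y^{\mathbf e}]\,\mathcal P_R\prod_{s\in\Omega\setminus R}\Bigl(1+v\,w_s(\mathbf e)e^{z/(1-s)}\sum_{a\in R}P_{a,s}(Z)Y_a\Bigr),$$ where exponentials are truncated to the needed finite order and $\mathcal L_{c_0}F(Z,z)=\sum_{i\ge0}\sum_{j=0}^{i}(-1)^j\frac{i!}{(i-j)!}c_0^{i-j}[Z^iz^j]F$. Each product is evaluated in a single pass over the elements $s$, retaining only the required coefficients. The contribution of the class, added to a sum $G$, is $$\frac{n!\,m}{\eta}\sum_{R}\frac{\prod_{a\in R}a^{\mu_a}}{\prod_{a\in R}\mu_a!}\sum_{|\mathbf e|=n}\Bigl(\prod_{a\in R}\tilde q_a^{\,e_a}\Bigr)\Psi_R(\mathbf e).$$ (For three or four double roots one may instead replace the factor $1/t$ by restricting to $e_1\ge e_a$ for all $a\in R$ and dividing each term by the number of $a\in R$ with $e_a$ maximal.) (4) *Result.* $D_n(r)\equiv m^{1-n}S+G\pmod p$. *)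

(* Defs.v *)
From mathcomp Require Import all_boot all_order all_algebra.

Set Implicit Arguments.
Unset Strict Implicit.
Unset Printing Implicit Defensive.

Import GRing.Theory.

(* An algorithm is a term of [prog V A] that is polymorphic in the type [V] of
   field elements: new elements of [V] arise only through the counted
   constructor [Op].  Everything else (root indices modulo m, multiplicity
   patterns, exponent vectors, table look-ups) is uncounted bookkeeping. *)

Inductive fop := FAdd | FSub | FMul | FDiv.

Inductive prog (V A : Type) : Type :=
| Ret of A
| Op of fop & V & V & (V -> prog V A).
Arguments Ret {V A} _.

Fixpoint bind V A B (c : prog V A) (f : A -> prog V B) : prog V B :=
  match c with
  | Ret a => f a
  | Op o x y k => Op o x y (fun z => bind (k z) f)
  end.

Notation "'let*' x := c 'in' k" := (bind c (fun x => k))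
  (at level 200, x name, c at level 100, k at level 200).

Definition fop_sem (F : fieldType) (o : fop) (x y : F) : option F :=
  match o with
  | FAdd => Some (x + y)%R
  | FSub => Some (x - y)%R
  | FMul => Some (x * y)%R
  | FDiv => if (y == 0)%R then None else Some (x / y)%R
  end.

(* The result together with the number of field operations performed; [None]
   if a division by zero is attempted. *)
Fixpoint run (F : fieldType) A (c : prog F A) : option (A * nat) :=
  match c with
  | Ret a => Some (a, 0)
  | Op o x y k =>
      if fop_sem o x y is Some z then
        omap (fun res => (res.1, res.2.+1)) (run (k z))
      else None
  end.

Fixpoint stirling2 (j v : nat) : nat :=
  match j, v with
  | 0, 0 => 1
  | 0, _.+1 | _.+1, 0 => 0
  | j'.+1, v'.+1 => v * stirling2 j' v + stirling2 j' v'
  end.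

(* The weakly decreasing lists of parts between 2 and [mx] with sum at most
   [n], for [fuel >= n]. *)
Fixpoint partitions_ge2 (fuel mx n : nat) : seq (seq nat) :=
  if fuel is f.+1 then
    [::] :: flatten [seq [seq q :: l | l <- partitions_ge2 f q (n - q)]
                    | q <- iota 2 (minn mx n).-1]
  else [:: [::]].

(* The number of distinct roots in a multiset of [n] roots with pattern [pat]. *)
Definition nb_distinct (n : nat) (pat : seq nat) : nat :=
  size pat + (n - sumn pat).

Definition feasible (n m : nat) (pat : seq nat) : bool :=
  (sumn pat <= n) && (nb_distinct n pat <= m).

(* The patterns of the elements of M_max. *)
Definition patterns (n m : nat) : seq (seq nat) :=
  [seq pat <- partitions_ge2 n n n | (pat != [::]) && feasible n m pat].

Definition G0 : seq (seq nat) :=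
  [:: [:: 2]; [:: 3]; [:: 2; 2]; [:: 3; 2]; [:: 2; 2; 2]; [:: 2; 2; 2; 2]].

(* The sublists of length [k]. *)
Fixpoint sublists T (k : nat) (s : seq T) : seq (seq T) :=
  match k, s with
  | 0, _ => [:: [::]]
  | _.+1, [::] => [::]
  | k'.+1, x :: s' => [seq x :: l | l <- sublists k' s'] ++ sublists k s'
  end.

(* The exponent vectors that are componentwise at most [b]. *)
Fixpoint box (b : seq nat) : seq (seq nat) :=
  if b is x :: b' then [seq i :: g | i <- iota 0 x.+1, g <- box b']
  else [:: [::]].

Definition subv (g u : seq nat) : seq nat :=
  [seq gu.1 - gu.2 | gu <- zip g u].

Definition unitv (t q : nat) : seq nat := mkseq (fun i => (i == q) : nat) t.

Section WorldCup.

(* [zero] and [one] are the constants 0 and 1 and [w] is the given primitive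
   m-th root of unity; they are the only field elements available initially.
   The element w^i of Omega is represented by its index i < m. *)
Variables (V : Type) (zero one w : V).

(* [alt t] selects, for a pattern of [t] >= 3 double roots, the variant in which
   the factor 1/t is replaced by a restriction on the exponent vectors. *)
Variables (n r : nat) (alt : nat -> bool).

Let m := r.+1.

Local Notation "x +! y" := (Op FAdd x y Ret) (at level 50).
Local Notation "x -! y" := (Op FSub x y Ret) (at level 50).
Local Notation "x *! y" := (Op FMul x y Ret) (at level 40).
Local Notation "x /! y" := (Op FDiv x y Ret) (at level 40).

Fixpoint mapM A B (f : A -> prog V B) (s : seq A) : prog V (seq B) :=
  if s is a :: s' then
    let* b := f a in let* bs := mapM f s' in Ret (b :: bs)
  else Ret [::].

Fixpoint foldM A B (f : B -> A -> prog V B) (b : B) (s : seq A) : prog V B :=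
  if s is a :: s' then let* b' := f b a in foldM f b' s' else Ret b.

Definition sumM A (s : seq A) (f : A -> prog V V) : prog V V :=
  foldM (fun acc a => let* x := f a in acc +! x) zero s.

Definition prodM A (s : seq A) (f : A -> prog V V) : prog V V :=
  foldM (fun acc a => let* x := f a in acc *! x) one s.

Definition powM (x : V) (k : nat) : prog V V := prodM (nseq k x) Ret.

(* (-1)^k x *)
Definition signM (k : nat) (x : V) : prog V V :=
  if odd k then zero -! x else Ret x.

(* k times 1 *)
Definition natM (k : nat) : prog V V := sumM (nseq k one) Ret.

(* The values [f k] for the keys [k] in [ks], computed once and stored. *)
Definition tabulate (K : eqType) (ks : seq K) (f : K -> prog V V) :
    prog V (K -> V) :=
  foldM (fun g k => let* x := f k in
                    Ret (fun k' => if k' == k then x else g k'))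
        (fun=> zero) ks.

(* The same for the keys 0, ..., N - 1, where the entry of index [k] is computed
   by [step g k] from the table [g] of the previous entries. *)
Definition tabrec (N : nat) (step : (nat -> V) -> nat -> prog V V) :
    prog V (nat -> V) :=
  foldM (fun g k => let* x := step g k in
                    Ret (fun k' => if k' == k then x else g k'))
        (fun=> zero) (iota 0 N).

Record tables := Tables {
  t_root : nat -> V;               (* i |-> w^i, for i < m *)
  t_int : nat -> V;                (* k |-> k, for k < m + 2n *)
  t_fact : nat -> V;               (* k |-> k!, for k <= n *)
  t_idiff : nat * nat -> V;        (* (i, j) |-> 1 / (w^i - w^j), for i != j *)
  t_powinv : nat * nat -> V;       (* (i, u) |-> (1 - w^i)^-u, for 0 < i, u <= n *)
  t_jbeta : nat -> V;              (* j |-> j beta_j, for 1 <= j <= n - 2 *)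
  t_mpow : nat -> V;               (* j |-> m^j, for j <= n *)
  t_Ctab : nat * nat -> V;         (* (i, j) |-> C_j(c / (1 - c)), for c = w^i *)
  t_jCtab : nat * nat * nat -> V   (* (i, j, u) |-> j u C_j(c / (1 - c)) *)
}.

(* With E(s) = (e^s - 1) / s = sum_i s^i / (i+1)!, the equality
   sum_j beta_j s^j = - log E(s) amounts to s B'(s) E(s) = - s E'(s), that is
   j beta_j = - j E_j - sum_(1 <= i < j) (i beta_i) E_(j-i). *)
Definition jbeta_step (ints fact : nat -> V) (b : nat -> V) (j : nat) :
    prog V V :=
  let* x := ints j /! fact j.+1 in
  let* y := sumM (iota 1 j.-1) (fun i => b i /! fact (j - i).+1) in
  let* z := x +! y in
  zero -! z.

(* C_j(y) = 1/j! sum_(1 <= v <= j) (v-1)! S(j, v) y^v *)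
Definition Cpoly (fact : nat -> V) (j : nat) (y : V) : prog V V :=
  let* s := sumM (iota 1 j) (fun v =>
    let* c := natM (stirling2 j v) in
    let* c' := fact v.-1 *! c in
    let* yv := powM y v in
    c' *! yv) in
  s /! fact j.

Definition make_tables : prog V tables :=
  let* root := tabrec m (fun g i => if i is i'.+1 then g i' *! w else Ret one) in
  let* ints := tabrec (m + n.*2)
    (fun g i => if i is i'.+1 then g i' +! one else Ret zero) in
  let* fact := tabrec n.+1
    (fun g i => if i is i'.+1 then g i' *! ints i else Ret one) in
  let* idiff := tabulate [seq ij <- allpairs pair (iota 0 m) (iota 0 m)
                         | ij.1 != ij.2]
    (fun ij => let* d := root ij.1 -! root ij.2 in one /! d) in
  let* powinv := tabulate (allpairs pair (iota 1 m.-1) (iota 0 n.+1))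
    (fun iu => powM (idiff (0, iu.1)) iu.2) in
  let* jbeta := tabrec n.-1
    (fun b j => if j is 0 then Ret zero else jbeta_step ints fact b j) in
  let* mpow := tabulate (iota 0 n.+1) (powM (ints m)) in
  let* Ctab := tabulate (allpairs pair (iota 1 m.-1) (iota 1 (n - 2)))
    (fun ij => let* y := root ij.1 *! powinv (ij.1, 1) in
               Cpoly fact ij.2 y) in
  let* jCtab := tabulate
    (allpairs pair (allpairs pair (iota 1 m.-1) (iota 1 (n - 2))) (iota 1 n))
    (fun iju => let* ju := ints iju.1.2 *! ints iju.2 in
                ju *! Ctab iju.1) in
  Ret (Tables root ints fact idiff powinv jbeta mpow Ctab jCtab).

Variable T : tables.

(* The index of b / a, where a and b have indices [i] and [j]. *)
Definition quot (j i : nat) : nat := (j + (m - i)) %% m.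

(* The cached data of a repeated root a during the traversal: its index, its
   multiplicity, and the parts of C_a and of the numbers j l_{a,j}
   (1 <= j <= mu_a - 2) coming from the roots assigned so far. *)
Record cache := Cache {
  c_idx : nat;
  c_mul : nat;
  c_C : V;
  c_jl : nat -> V
}.

Definition cache_init (i mu : nat) : prog V cache :=
  let* c := t_int T m /! t_root T i in
  let* c' := signM mu c in
  let* jl := tabulate (iota 1 (mu - 2)) (fun j =>
    let* d := t_int T mu -! t_mpow T j in
    let* x := d *! t_jbeta T j in
    if j == 1 then x -! t_int T r else Ret x) in
  Ret (Cache i mu c' jl).

(* Takes into account the root of index [b.1] with multiplicity [b.2]. *)
Definition cache_update (c : cache) (b : nat * nat) : prog V cache :=
  let q := quot b.1 (c_idx c) in
  let* C := c_C c *! t_powinv T (q, b.2) in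
  let* jl := tabulate (iota 1 (c_mul c - 2)) (fun j =>
    c_jl c j +! t_jCtab T (q, j, b.2)) in
  Ret (Cache (c_idx c) (c_mul c) C jl).

(* A partial multiset: the assigned pairs (index, multiplicity), the latest one
   first, and the caches of the repeated roots among them. *)
Definition partial : Type := seq (nat * nat) * seq cache.

Definition assign (st : partial) (b : nat * nat) : prog V partial :=
  let* caches := mapM (fun c => cache_update c b) st.2 in
  if 2 <= b.2 then
    let* c0 := cache_init b.1 b.2 in
    let* c := foldM cache_update c0 st.1 in
    Ret (b :: st.1, c :: caches)
  else Ret (b :: st.1, caches).

(* The admissible indices for the next part [mu].  Parts are assigned in weakly
   decreasing order and the indices of equal parts increase, so that each
   multiset is met once; the first part, of maximal size, goes to the root 1. *)
Definition candidates (done : seq (nat * nat)) (mu : nat) : seq nat :=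
  if done is (j, nu) :: _ then
    [seq i <- iota 0 m | (i \notin unzip1 done) && ((nu == mu) ==> (j < i))]
  else [:: 0].

(* f_{a,0}, ..., f_{a,mu_a-2} *)
Definition f_coefs (c : cache) : prog V (nat -> V) :=
  tabrec (c_mul c).-1 (fun f j =>
    if j is 0 then Ret one else
    let* s := sumM (iota 1 j) (fun i => c_jl c i *! f (j - i)) in
    s /! t_int T j).

Definition multM (muls : seq nat) : prog V V :=
  let* d := prodM muls (fun mu => Ret (t_fact T mu)) in
  t_fact T n /! d.

Definition eta (muls : seq nat) : nat := count_mem (foldr maxn 0 muls) muls.

(* mult(M) Theta_0(M) / eta(M) *)
Definition evaluate (st : partial) : prog V V :=
  let M := st.1 in
  let* cfs := mapM (fun c => let* f := f_coefs c in Ret (c, f)) st.2 in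
  let* h_r := sumM cfs (fun cf =>
    let: (c, f) := cf in c_C c *! f (c_mul c - 2)) in
  let* h_r1 := sumM cfs (fun cf =>
    let: (c, f) := cf in
    let* x := c_C c /! t_root T (c_idx c) in
    let* y := sumM (iota 0 (c_mul c).-1)
      (fun j => f j /! t_fact T (c_mul c - 2 - j)) in
    x *! y) in
  let* p1 := prodM M (fun a => powM (t_root T a.1) a.2) in
  let* p2 := prodM M (fun a =>
    let* x := t_root T a.1 *! h_r1 in
    let* y := h_r -! x in
    powM y a.2) in
  let* theta := p1 *! p2 in
  let* mult := multM (unzip2 M) in
  let* x := mult *! theta in
  x /! t_int T (eta (unzip2 M)).

Fixpoint traverse (parts : seq nat) (st : partial) (acc : V) : prog V V :=
  if parts is mu :: parts' then
    foldM (fun acc i => let* st' := assign st (i, mu) in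
                        traverse parts' st' acc)
          acc (candidates st.1 mu)
  else let* x := evaluate st in acc +! x.

Definition residual_sum : prog V V :=
  foldM (fun acc pat =>
           traverse (pat ++ nseq (n - sumn pat) 1) ([::], [::]) acc)
        zero [seq pat <- patterns n m | pat \notin G0].

(* For a pattern [pat], [R] is the list of the indices of the elements of the
   set R, its head being the index 0 of the root 1, and [nth 0 pat q] is the
   multiplicity of the q-th element of R.  A monomial v^h Z^i z^j Y^y is
   represented by the list h :: i :: j :: y, and a polynomial truncated at the
   exponent vector [bd] by the table of its coefficients on [box bd]. *)

Definition triple (pat : seq nat) : bool := head 0 pat == 3.

(* For the patterns considered, q~_a is a^(n-4) prod_(b != a) (a-b)^-mu_b:
   for (3) and (3,2) the power of a = 1 is 1, and for (3,2) the only
   b != a in R, when a != 1, is the triple root 1. *)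
Definition qtilde (pat R : seq nat) (q : nat) : prog V V :=
  let a := nth 0 R q in
  let* x := powM (t_root T a) (n - 4) in
  let* y := prodM [seq u <- iota 0 (size R) | u != q]
    (fun u => powM (t_idiff T (a, nth 0 R u)) (nth 0 pat u)) in
  x *! y.

(* c_0 = (m + 2n - 7) / 2 - 2 sum_(b in D) 1 / (1 - b) *)
Definition c0M (R : seq nat) : prog V V :=
  let* x := t_int T (m + n.*2 - 7) /! t_int T 2 in
  let* s := sumM (behead R) (fun b => Ret (t_idiff T (0, b))) in
  let* y := t_int T 2 *! s in
  x -! y.

(* The coefficient of Z^i in P_{a,x}(Z), a being the q-th element of R. *)
Definition Pcoef (pat R : seq nat) (q x i : nat) : prog V V :=
  if triple pat && (q == 0) then
    match i with
    | 0 => Ret one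
    | 1 => one -! t_root T x
    | _ => Ret zero
    end
  else if i == 0 then t_root T (nth 0 R q) -! t_root T x else Ret zero.

(* The coefficient of Z^i Y^y in sum_(a in R) P_{a,x}(Z) Y_a. *)
Definition lincoef (pat R : seq nat) (x i : nat) (y : seq nat) : prog V V :=
  if [seq q <- iota 0 (size R) | y == unitv (size R) q] is q :: _ then
    Pcoef pat R q x i
  else Ret zero.

Definition poly_mul (bd : seq nat) (P Q : seq nat -> V) :
    prog V (seq nat -> V) :=
  tabulate (box bd)
    (fun g => sumM (box g) (fun u => P u *! Q (subv g u))).

Definition poly_one (bd : seq nat) : prog V (seq nat -> V) :=
  tabulate (box bd) (fun g => Ret (if sumn g == 0 then one else zero)).

Definition lin_factor (pat R bd : seq nat) (x : nat) :
    prog V (seq nat -> V) :=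
  tabulate (box bd) (fun g =>
    if g is [:: 0, i, 0 & y] then lincoef pat R x i y else Ret zero).

Definition P_R (pat R bd : seq nat) : prog V (seq nat -> V) :=
  let* one_ := poly_one bd in
  foldM (fun P bmu =>
           let* L := lin_factor pat R bd bmu.1 in
           foldM (fun P _ => poly_mul bd P L) P (iota 0 bmu.2))
        one_ (zip R pat).

(* w_s(e) = s prod_(a in R) (a - s)^-e_a *)
Definition weight (R e : seq nat) (s : nat) : prog V V :=
  let* x := prodM (zip R e) (fun ae => powM (t_idiff T (ae.1, s)) ae.2) in
  t_root T s *! x.

(* 1 + v w_s(e) e^(z/(1-s)) sum_(a in R) P_{a,s}(Z) Y_a.  In the all-double
   case the truncation vector is 0 at Z and z, and the exponential is 1. *)
Definition pass_factor (pat R e bd : seq nat) (s : nat) :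
    prog V (seq nat -> V) :=
  let* ws := weight R e s in
  tabulate (box bd) (fun g =>
    match g with
    | [:: 0, i, j & y] =>
        Ret (if sumn [:: i, j & y] == 0 then one else zero)
    | [:: 1, i, j & y] =>
        let* l := lincoef pat R s i y in
        let* ex := t_powinv T (s, j) /! t_fact T j in
        let* x := ws *! ex in
        x *! l
    | _ => Ret zero
    end).

(* L_{c_0}, applied to the polynomial sum_(i, j <= D) F i j Z^i z^j *)
Definition L_op (c0 : V) (D : nat) (F : nat -> nat -> V) : prog V V :=
  sumM (iota 0 D.+1) (fun i => sumM (iota 0 i.+1) (fun j =>
    let* x := t_fact T i /! t_fact T (i - j) in
    let* y := powM c0 (i - j) in
    let* z := x *! y in
    let* t := z *! F i j in
    signM j t)).

(* Psi_R(e).  In the coefficient of Y^e, the exponents of Z are at most e_1,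
   because Z only occurs in the coefficients of Y_1, and L_{c_0} only involves
   powers of z that are at most the power of Z. *)
Definition Psi (pat R e : seq nat) (c0 : V) : prog V V :=
  let k := n - sumn pat in
  let D := if triple pat then head 0 e else 0 in
  let bd := [:: k, D, D & e] in
  let* P0 := P_R pat R bd in
  let* P := foldM (fun P s => let* Q := pass_factor pat R e bd s in
                              poly_mul bd P Q)
                  P0 [seq s <- iota 0 m | s \notin R] in
  if triple pat then L_op c0 D (fun i j => P [:: k, i, j & e])
  else Ret (P [:: k, 0, 0 & e]).

Definition use_alt (pat : seq nat) : bool :=
  [&& ~~ triple pat, 3 <= size pat & alt (size pat)].

Definition exponents (pat : seq nat) : seq (seq nat) :=
  [seq e <- box (nseq (size pat) n) | (sumn e == n) &&
     (use_alt pat ==> all (fun ea => ea <= head 0 e) e)].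

Definition class_term (pat R : seq nat) : prog V V :=
  let* num := prodM (zip R pat) (fun amu => powM (t_root T amu.1) amu.2) in
  let* den := prodM pat (fun mu => Ret (t_fact T mu)) in
  let* pre := num /! den in
  let* qt := tabulate (iota 0 (size R)) (qtilde pat R) in
  let* c0 := if triple pat then c0M R else Ret zero in
  let* s := sumM (exponents pat) (fun e =>
    let* Q := prodM (zip (iota 0 (size R)) e) (fun qe => powM (qt qe.1) qe.2) in
    let* psi := Psi pat R e c0 in
    let* x := Q *! psi in
    if use_alt pat then x /! t_int T (eta e) else Ret x) in
  pre *! s.

(* The contribution of the class of the pattern [pat] != (2). *)
Definition class_sum (pat : seq nat) : prog V V :=
  let* s := sumM [seq 0 :: D | D <- sublists (size pat).-1 (iota 1 m.-1)]
                 (class_term pat) in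
  let* x := t_fact T n *! t_int T m in
  let* y := x *! s in
  if use_alt pat then Ret y else y /! t_int T (eta pat).

Definition class_sums : prog V V :=
  sumM [seq pat <- patterns n m | (pat \in G0) && (pat != [:: 2])] class_sum.

End WorldCup.

(* The optimized World Cup calculation of D_n(r), returning m^(1-n) S + G. *)
Definition world_cup (V : Type) (zero one w : V) (n r : nat)
    (alt : nat -> bool) : prog V V :=
  let* T := make_tables zero one w n r in
  let* S := residual_sum zero one n r T in
  let* G := class_sums zero one n r alt T in
  let* S' := Op FDiv S (t_mpow T n.-1) Ret in
  Op FAdd S' G Ret.

(* Main.v *)
Require Import Defs.
From mathcomp Require Import all_boot all_order all_algebra zify.

(* Divisions are only by powers of w, differences of distinct powers of w,
   factorials and integers between 1 and n, and powers of m; all are nonzero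
   because w is primitive, p > 2n and m < p.

   For the operation count, the tables cost O_n(m^2).  A pattern outside G0
   satisfies sum (mu - 1) >= 3, so that its multisets have at most n - 3
   distinct elements; one of them is the root 1, which leaves O_n(m^(n-4))
   partial assignments, each of cost O_n(1).  A class with t <= 4 repeated
   roots has at most m^(t-1) sets R, and for each of them O_n(1) passes over
   the O(m) elements outside R, with O_n(1) operations per element because the
   truncated polynomials have O_n(1) coefficients: O_n(m^t) in total. *)

Set Implicit Arguments.
Unset Strict Implicit.
Unset Printing Implicit Defensive.

Import GRing.Theory.

(** A Hoare triple with a cost bound. As [run] yields [None] on a division by zero, it also
    certifies that every division performed is legal; [Q] carries the nonvanishing of computed
    values to the later divisions by them. *)
Definition within (F : fieldType) A (B : nat) (c : prog F A) (Q : A -> Prop) :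
    Prop :=
  exists2 res, run c = Some res & res.2 <= B /\ Q res.1.

Notation bounded B c := (within B c (fun=> True)).

(** * Cost rules for programs, loops and tabulations *)

Section Within.

Variable F : fieldType.

Lemma within_weaken A B B' (c : prog F A) (Q Q' : A -> Prop) :
  within B c Q -> B <= B' -> (forall a, Q a -> Q' a) -> within B' c Q'.
Proof.
move=> [res run_c [le_B Qa]] leBB' QQ'; exists res => //.
by split; [apply: leq_trans leBB' | apply: QQ'].
Qed.

Lemma within_leq A B B' (c : prog F A) (Q : A -> Prop) :
  within B c Q -> B <= B' -> within B' c Q.
Proof. by move=> cQ leBB'; apply: (within_weaken cQ leBB'). Qed.

Lemma within_bounded A B (c : prog F A) Q : within B c Q -> bounded B c.
Proof. by move=> cQ; apply: (within_weaken cQ (leqnn B)). Qed.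

Lemma within_ret A (a : A) (Q : A -> Prop) : Q a -> within 0 (Ret a : prog F A) Q.
Proof. by move=> Qa; exists (a, 0). Qed.

Lemma within_retW B A (a : A) (Q : A -> Prop) :
  Q a -> within B (Ret a : prog F A) Q.
Proof. by move=> Qa; exists (a, 0). Qed.

Lemma within_op A o (x y : F) (k : F -> prog F A) B Q :
  (o = FDiv -> y != 0%R) ->
  (forall z, fop_sem o x y = Some z -> within B (k z) Q) ->
  within B.+1 (Op o x y k) Q.
Proof.
move=> y_neq0 kP.
have [z def_z] : exists z, fop_sem o x y = Some z.
  case: o y_neq0 {kP} => /= y_neq0; try by eexists.
  by rewrite (negbTE (y_neq0 _)) //; eexists.
have [res run_k [le_B Qres]] := kP z def_z.
by exists (res.1, res.2.+1) => //=; rewrite def_z run_k.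
Qed.

Lemma bounded_op o (x y : F) : (o = FDiv -> y != 0%R) ->
  bounded 1 (Op o x y Ret).
Proof. by move=> y_neq0; apply: within_op => // z _; apply: within_ret. Qed.

Lemma within_mul (x y : F) (Q : F -> Prop) :
  Q (x * y)%R -> within 1 (Op FMul x y Ret) Q.
Proof. by move=> Qxy; apply: within_op => // z [<-]; apply: within_ret. Qed.

Lemma within_bind A A' B1 B2 (c : prog F A) (f : A -> prog F A') P Q :
  within B1 c P -> (forall a, P a -> within B2 (f a) Q) ->
  within (B1 + B2) (bind c f) Q.
Proof.
move=> + fQ; elim: c B1 => [a|o x y k IHk] B1 [res /= run_c [le_B Pres]].
  case: run_c le_B Pres => <- _ /= /fQ.
  by move/within_leq; apply; apply: leq_addl.
case def_z: (fop_sem o x y) run_c => [z|//].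
case run_k: (run (k z)) => [res'|//] [def_res].
move: le_B Pres; rewrite -{}def_res /= => le_B Pres.
(* The induction hypothesis is used at the exact cost [res'.2] of the continuation, which leaves
   room for the operation just executed. *)
have {}IHk: within (res'.2 + B2) (bind (k z) f) Q by apply: IHk; exists res'.
have [res2 run2 [le2 Q2]] := IHk.
exists (res2.1, res2.2.+1) => /=; first by rewrite def_z run2.
by split=> //; lia.
Qed.

Lemma bounded_bind A A' B1 B2 (c : prog F A) (f : A -> prog F A') Q :
  bounded B1 c -> (forall a, within B2 (f a) Q) -> within (B1 + B2) (bind c f) Q.
Proof. by move=> cP fQ; apply: within_bind cP _ => a _. Qed.

(** Keeps a common factor [X], a power of [m], outside the sum, so that the constant in front can be
    a single unknown depending on [n] only. *)
Lemma within_bind_scaled A A' X K1 K2 (c : prog F A) (f : A -> prog F A') P Q :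
  within (K1 * X) c P -> (forall a, P a -> within (K2 * X) (f a) Q) ->
  within ((K1 + K2) * X) (bind c f) Q.
Proof. by rewrite mulnDl; apply: within_bind. Qed.

(** With a sum in place of a maximum, each branch determines its own unknown constant separately. *)
Lemma within_if A (b : bool) B1 B2 (c1 c2 : prog F A) Q :
  (b -> within B1 c1 Q) -> (~~ b -> within B2 c2 Q) ->
  within (B1 + B2) (if b then c1 else c2) Q.
Proof.
by case: b => [/(_ isT) c1Q _ | _ /(_ isT) c2Q];
  [apply: within_leq c1Q _ | apply: within_leq c2Q _]; lia.
Qed.

(** Loop rule with invariant [I]. The elements are constrained by a predicate and not by membership,
    because caches contain functions and have no decidable equality. *)
Lemma foldM_pred A S N B (D : pred A) (f : S -> A -> prog F S) s (I : S -> Prop)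
    x0 :
  all D s -> size s <= N -> I x0 ->
  (forall x a, D a -> I x -> within B (f x a) I) ->
  within (N * B) (foldM f x0 s) I.
Proof.
move=> sD le_N Ix0 fI; apply: (@within_leq _ (size s * B)); last first.
  by rewrite leq_mul2r le_N orbT.
elim: s x0 Ix0 sD {le_N} => [|a s IHs] x0 Ix0 /= => [_|/andP[Da sD]].
  exact: within_ret.
by rewrite mulSn; apply: within_bind (fI _ _ Da Ix0) _ => x1 /IHs; apply.
Qed.

Lemma within_foldM (A : eqType) S N B (f : S -> A -> prog F S) s
    (I : S -> Prop) x0 :
  size s <= N -> I x0 ->
  (forall x a, a \in s -> I x -> within B (f x a) I) ->
  within (N * B) (foldM f x0 s) I.
Proof. by apply: foldM_pred; apply/allP. Qed.

Lemma mapM_pred A A' N B (D : pred A) (E : pred A') (f : A -> prog F A') s :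
  all D s -> size s <= N ->
  (forall a, D a -> within B (f a) E) ->
  within (N * B) (mapM f s) (fun t => all E t /\ size t = size s).
Proof.
move=> sD le_N fE; apply: (@within_leq _ (size s * B)); last first.
  by rewrite leq_mul2r le_N orbT.
elim: s sD {le_N} => [_|a s IHs /= /andP[Da sD]]; first exact: within_ret.
rewrite mulSn; apply: within_bind (fE _ Da) _ => b Eb.
rewrite -[size s * B]addn0; apply: within_bind (IHs sD) _ => t [tE sz_t].
by apply: within_ret; rewrite /= Eb sz_t.
Qed.

Lemma sumM_pred A N B (D : pred A) (f : A -> prog F F) s x0 :
  all D s -> size s <= N -> (forall a, D a -> bounded B (f a)) ->
  bounded (N * (B + 1)) (sumM x0 s f).
Proof.
move=> sD le_N fB; apply: foldM_pred sD le_N _ _ => // x a /fB fa _.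
by apply: bounded_bind fa _ => y; apply: bounded_op.
Qed.

Lemma bounded_sumM (A : eqType) N B (f : A -> prog F F) s x0 :
  size s <= N -> (forall a, a \in s -> bounded B (f a)) ->
  bounded (N * (B + 1)) (sumM x0 s f).
Proof. by apply: sumM_pred; apply/allP. Qed.

Lemma bounded_prodM (A : eqType) N B (f : A -> prog F F) s x0 :
  size s <= N -> (forall a, a \in s -> bounded B (f a)) ->
  bounded (N * (B + 1)) (prodM x0 s f).
Proof.
move=> le_N fB; apply: within_foldM le_N _ _ => // x a /fB fa _.
by apply: bounded_bind fa _ => y; apply: bounded_op.
Qed.

(** Needed for products that later occur as divisors, such as the product of the factorials of the
    multiplicities. *)
Lemma prodM_neq0 (A : eqType) N B (f : A -> prog F F) s :
  size s <= N -> (forall a, a \in s -> within B (f a) (fun x => x != 0%R)) ->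
  within (N * (B + 1)) (prodM 1%R s f) (fun x => x != 0%R).
Proof.
move=> le_N fB; apply: within_foldM le_N _ _ => [|x a /fB fa x_neq0].
  exact: oner_neq0.
by apply: within_bind fa _ => y y_neq0; apply/within_mul/mulf_neq0.
Qed.

Lemma bounded_powM N x k : k <= N -> bounded (N * (0 + 1)) (powM 1%R (x : F) k).
Proof.
by move=> le_k; apply: bounded_prodM => [|*];
  [rewrite size_nseq | apply: within_ret].
Qed.

Lemma powM_neq0 N x k : k <= N -> x != 0%R ->
  within (N * (0 + 1)) (powM 1%R (x : F) k) (fun y => y != 0%R).
Proof.
move=> le_k x_neq0; apply: prodM_neq0; first by rewrite size_nseq.
by move=> y /nseqP[-> _]; apply: within_ret.
Qed.

Lemma bounded_natM k : bounded (k * (0 + 1)) (natM 0%R (1%R : F) k).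
Proof. by apply: bounded_sumM => [|*];
  [rewrite size_nseq | apply: within_ret]. Qed.

Lemma bounded_signM k (x : F) : bounded (1 + 0) (signM 0%R k x).
Proof. by apply: within_if => _; [apply: bounded_op | apply: within_ret]. Qed.

Lemma within_tabulate (K : eqType) N B (ks : seq K) (f : K -> prog F F)
    (P : K -> F -> Prop) :
  size ks <= N -> (forall k, k \in ks -> within B (f k) (P k)) ->
  within (N * B) (tabulate 0%R ks f) (fun g => forall k, k \in ks -> P k (g k)).
Proof.
move=> le_N fP; apply: (@within_leq _ (size ks * B)); last first.
  by rewrite leq_mul2r le_N orbT.
(* Generalized to an arbitrary starting table: an entry that is already correct stays so, since
   overwriting a repeated key reestablishes [P] for that key. *)
suff foldP s (g : K -> F) : {subset s <= ks} ->
    within (size s * B) (foldM (fun g k => let* x := f k in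
                    Ret (fun k' => if k' == k then x else g k')) g s)
      (fun g' => forall k, k \in s \/ P k (g k) -> P k (g' k)).
  apply: within_weaken (foldP ks _ _) _ _ => // g gP k k_ks; apply: gP.
  by left.
elim: s g => [|k s IHs] g sks /=; first by apply: within_ret => k [].
rewrite mulSn; apply: (@within_bind _ _ _ _ _ _ (fun g' => P k (g' k) /\
  forall k', P k' (g k') -> P k' (g' k'))).
  rewrite -[B]addn0; apply: within_bind.
    by apply: fP; apply: sks; rewrite mem_head.
  move=> x Px; apply: within_ret; rewrite eqxx; split=> // k'.
  by case: eqVneq => [->|].
move=> g' [Pk gg']; apply: within_weaken (IHs g' _) _ _ => //.
  by move=> k' k's; apply: sks; rewrite inE k's orbT.
move=> g2 g2P k' [|/gg' Pk']; last by apply: g2P; right.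
by rewrite inE => /predU1P[->|k's]; apply: g2P; [right | left].
Qed.

Lemma bounded_tabulate (K : eqType) N B (ks : seq K) (f : K -> prog F F) :
  size ks <= N -> (forall k, k \in ks -> bounded B (f k)) ->
  bounded (N * B) (tabulate 0%R ks f).
Proof.
move=> le_N fB.
exact: within_bounded (within_tabulate (P := fun _ _ => True) le_N fB).
Qed.

Lemma within_tabrec N M B (step : (nat -> F) -> nat -> prog F F)
    (P : nat -> F -> Prop) :
  N <= M ->
  (forall g k, k < N -> (forall i, i < k -> P i (g i)) ->
    within B (step g k) (P k)) ->
  within (M * B) (tabrec 0%R N step) (fun g => forall i, i < N -> P i (g i)).
Proof.
move=> le_M stepP; apply: (@within_leq _ (N * B)); last first.
  by rewrite leq_mul2r le_M orbT.
(* Generalized to a start in the middle of the table, where the entries below [b] are already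
   correct. *)
suff foldP k b (g : nat -> F) : b + k = N -> (forall i, i < b -> P i (g i)) ->
    within (k * B) (foldM (fun g k => let* x := step g k in
                    Ret (fun k' => if k' == k then x else g k')) g (iota b k))
      (fun g' => forall i, i < N -> P i (g' i)) by exact: foldP.
elim: k b g => [|k IHk] b g /= def_N gP.
  by apply: within_ret => i; rewrite -def_N addn0; apply: gP.
rewrite mulSn; apply: (@within_bind _ _ _ _ _ _
  (fun g' => forall i, i < b.+1 -> P i (g' i))).
  rewrite -[B]addn0; apply: within_bind (stepP g b _ gP) _; first by lia.
  move=> x Px; apply: within_ret => i; rewrite ltnS leq_eqVlt.
  by case: eqVneq => [-> | _] //=; apply: gP.
by move=> g' g'P; apply: IHk g'P; lia.
Qed.

Lemma bounded_tabrec N M B (step : (nat -> F) -> nat -> prog F F) :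
  N <= M -> (forall g k, k < N -> bounded B (step g k)) ->
  bounded (M * B) (tabrec 0%R N step).
Proof.
move=> le_M sB; apply: within_bounded.
by apply: (within_tabrec (P := fun _ _ => True) le_M) => g k /sB.
Qed.

End Within.

(** Meant for goals whose bound is still an existential variable, which collects the constants along
    the program. When [eexists] creates it before the field, [r] and the tables are introduced, it
    can depend on [n] only. A division leaves the side goal that its divisor is nonzero. *)
Ltac bounded_step :=
  lazymatch goal with
  | |- within _ (let _ := _ in _) _ => cbv zeta; bounded_step
  | |- within _ (Ret _) _ => apply: within_ret => //
  | |- within _ (Op _ _ _ Ret) _ => apply: bounded_op => //
  | |- within _ (Op _ _ _ _) _ => eapply within_op; [done | intros ? _]
  | |- within _ (bind _ _) _ => eapply bounded_bind; [|intros ?]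
  end.

(** * Cost of the precomputed tables *)

(** [natM] builds an integer by repeated addition of 1, so the size of the Stirling numbers enters
    the cost; only finitely many occur for given [n]. *)
Lemma stirling2_bounded n : exists S, forall j v,
  j <= n -> v <= n -> stirling2 j v <= S.
Proof.
exists (\max_(j < n.+1) \max_(v < n.+1) stirling2 j v) => j v le_j le_v.
apply: leq_trans (leq_bigmax (Ordinal (le_j : j < n.+1))).
exact: (leq_bigmax (Ordinal (le_v : v < n.+1))).
Qed.

Lemma jbeta_step_bounded (F : fieldType) n ints fact (b : nat -> F) j :
  j < n -> (forall k, k <= n -> fact k != 0%R) ->
  bounded (1 + (n * (1 + 1) + (1 + 1))) (jbeta_step 0%R ints fact b j).
Proof.
move=> lt_jn fact_neq0; rewrite /jbeta_step.
do 2?bounded_step; first by move=> _; apply: fact_neq0.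
  apply: bounded_sumM => [|i]; first by rewrite size_iota; lia.
  rewrite mem_iota => i_j; bounded_step => _; apply: fact_neq0; lia.
by do 3!bounded_step.
Qed.

Lemma Cpoly_bounded n : exists K, forall (F : fieldType) fact j (y : F),
  j <= n -> (forall k, k <= n -> fact k != 0%R) ->
  bounded K (Cpoly 0%R 1%R fact j y).
Proof.
have [S leS] := stirling2_bounded n.
eexists=> F fact j y le_j fact_neq0; rewrite /Cpoly.
bounded_step; last by bounded_step => _; apply: fact_neq0.
apply: (bounded_sumM (N := n)); first by rewrite size_iota.
move=> v; rewrite mem_iota => v_j.
bounded_step.
  apply: (within_leq (B' := S * (0 + 1)) (bounded_natM F _)).
  by rewrite leq_mul2r; apply: leS; lia.
do 3?bounded_step.
by apply: (bounded_powM (N := n)); lia.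
Qed.

(** The table entries by which, directly or through products of factorials, the later stages
    divide. *)
Definition good_tables (F : fieldType) (n m : nat) (T : tables F) : Prop :=
  [/\ forall i, i < m -> t_root T i != 0%R,
      forall k, 0 < k <= n -> t_int T k != 0%R,
      forall k, k <= n -> t_fact T k != 0%R
    & t_mpow T n.-1 != 0%R].

Lemma mem_allpairs_pair (A B : eqType) (s : seq A) (t : seq B) x y :
  ((x, y) \in allpairs pair s t) = (x \in s) && (y \in t).
Proof.
by apply/allpairsP/andP => [[[x' y'] /= [? ? [-> ->]]]|[]]; last exists (x, y).
Qed.

(** The inverse differences, indexed by pairs of roots, force the factor [m^2]; every other table
    has [O_n(m)] entries, and each entry costs [O_n(1)]. *)
Lemma make_tables_within n : 2 <= n -> exists K, forall (F : fieldType) r (w : F),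
  (forall k, 0 < k <= n -> (k%:R != 0 :> F)%R) ->
  (r.+1%:R != 0 :> F)%R -> r.+1.-primitive_root%R w ->
  within (K * r.+1 ^ 2) (make_tables 0%R 1%R w n r) (good_tables n r.+1).
Proof.
move=> n_ge2; have [KC CpolyP] := Cpoly_bounded n.
eexists=> F r w char_n char_m prim_w; rewrite /make_tables; set X := r.+1 ^ 2.
have X_gt0 : 0 < X by rewrite expn_gt0.
have le_mX : r.+1 <= X by rewrite -[leqLHS]expn1 leq_pexp2l.
(* Here [N * X] bounds the number of entries and [B] the cost of one entry. *)
have scale N B A (c : prog F A) Q :
    within (N * X * B) c Q -> within (N * B * X) c Q by rewrite mulnAC.
apply: within_bind_scaled => [|root rootP].
  (* The exact values [w^i] are recorded: they are what shows below that the roots and their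
     differences are nonzero. *)
  apply/scale/(within_tabrec (M := 1 * X)
    (P := fun i v => v = (w ^+ i)%R)) => [|g [|i] lt_i gP].
  - by rewrite mul1n.
  - by apply: (within_retW _ 1).
  by apply: within_mul; rewrite gP // exprSr.
have root_neq0 i : i < r.+1 -> root i != 0%R.
  (* If [w] were 0, its [m]-th power could not be 1. *)
  move=> /rootP->; apply: expf_neq0; apply/eqP => w0.
  by move/eqP: (prim_expr_order prim_w); rewrite w0 expr0n eq_sym oner_eq0.
apply: within_bind_scaled => [|ints intsP].
  apply/scale/(within_tabrec (M := (1 + n.*2) * X)
    (P := fun i v => v = i%:R%R)) => [|g [|i] lt_i gP].
  - by rewrite mulnDl mul1n leq_add // leq_pmulr.
  - by apply: (within_retW _ 1).
  apply: within_op => // z [<-]; apply: within_ret.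
  by rewrite gP // natr1.
have ints_neq0 k : 0 < k <= n -> ints k != 0%R.
  by move=> k_n; rewrite intsP ?char_n //; lia.
apply: within_bind_scaled => [|fact factP].
  apply/scale/(within_tabrec (M := n.+1 * X)
    (P := fun i v => v != 0%R)) => [|g [|i] lt_i gP].
  - by rewrite leq_pmulr.
  - by apply: (within_retW _ 1); apply: oner_neq0.
  by apply: within_mul; rewrite mulf_neq0 ?gP // ints_neq0.
have {}factP k : k <= n -> fact k != 0%R by exact: factP.
apply: within_bind_scaled => [|idiff _].
  apply: scale; apply: (bounded_tabulate (N := 1 * X) (B := 2)) => [|[i j]].
    by rewrite mul1n size_filter (leq_trans (count_size _ _)) // size_allpairs
      !size_iota mulnn.
  rewrite mem_filter mem_allpairs_pair !mem_iota /= => /and3P[neq_ij lt_i lt_j].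
  apply: within_op => // z [<-]; bounded_step => _.
  (* By primitivity, two powers of [w] agree only if their exponents are congruent mod [m]; distinct
     indices below [m] are not. *)
  rewrite subr_eq0 !rootP // (eq_prim_root_expr prim_w).
  by rewrite !modn_small.
apply: within_bind_scaled => [|powinv _].
  apply: scale; apply: (bounded_tabulate (N := n.+1 * X)) => [|[i u]].
    rewrite size_allpairs !size_iota mulnC leq_mul2l /=.
    by apply: leq_trans le_mX.
  rewrite mem_allpairs_pair !mem_iota /= => /andP[_ lt_u].
  exact: (bounded_powM (N := n)).
apply: within_bind_scaled => [|jbeta _].
  apply: scale; apply: (bounded_tabrec (M := n * X)) => [|g [|j] lt_j]; last first.
  - by apply: (jbeta_step_bounded (n := n)) => //; lia.
  - exact: within_retW.
  by rewrite (leq_trans (leq_pred n)) ?leq_pmulr.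
apply: within_bind_scaled => [|mpow mpowP].
  apply/scale/(within_tabulate (N := n.+1 * X)
    (P := fun _ v => v != 0%R)).
    by rewrite size_iota leq_pmulr.
  move=> k; rewrite mem_iota /= add0n => lt_k.
  by apply: (powM_neq0 (N := n)); rewrite ?intsP //; lia.
apply: within_bind_scaled => [|Ctab _].
  apply: scale; apply: (bounded_tabulate (N := n * X)) => [|[i j]].
    by rewrite size_allpairs !size_iota mulnC leq_mul // ?leq_subr //
      (leq_trans _ le_mX).
  rewrite mem_allpairs_pair !mem_iota /= => /andP[_ j_n].
  by bounded_step; apply: CpolyP; rewrite //; lia.
apply: within_bind_scaled => [|jCtab _].
  apply: scale; apply: (bounded_tabulate (N := n * n * X)) => [|[[i j] u] _].
    rewrite !size_allpairs !size_iota mulnC -mulnA leq_mul //.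
    by rewrite mulnC leq_mul // ?leq_subr // (leq_trans _ le_mX).
  by do 2!bounded_step.
apply: (within_retW _ (0 * X)); split=> //=.
by apply: mpowP; rewrite mem_iota; lia.
Qed.

Lemma Fp_natr_neq0 p k : prime p -> 0 < k < p -> (k%:R != 0 :> 'F_p)%R.
Proof.
move=> p_pr k_p; rewrite -(dvdn_pcharf (pchar_Fp p_pr)).
by apply/negP => /dvdn_leq; lia.
Qed.

(** * Residual evaluations and their traversal *)

Definition good_cache (F : fieldType) (n m : nat) (c : cache F) : bool :=
  (c_idx c < m) && (c_mul c <= n).

(** The invariant that makes every loop over assigned roots, caches or expansion orders have
    [O_n(1)] steps and every index point to a nonzero root. *)
Definition good_partial (F : fieldType) (n m : nat) (st : partial F) : bool :=
  [&& all (fun b => (b.1 < m) && (b.2 <= n)) st.1, all (good_cache n m) st.2,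
      size st.1 <= n & size st.2 <= size st.1].

Lemma cache_update_within (F : fieldType) n r (T : tables F) c b :
  c_mul c <= n ->
  within (1 + (n * 1 + 0)) (cache_update 0%R r T c b)
    (fun c' => c_idx c' = c_idx c /\ c_mul c' = c_mul c).
Proof.
move=> le_mul; rewrite /cache_update; bounded_step; first by bounded_step.
bounded_step; last by apply: within_ret.
apply: (bounded_tabulate (N := n)) => [|j _]; first by rewrite size_iota; lia.
by bounded_step.
Qed.

Lemma cache_init_within n : exists K,
  forall (F : fieldType) r (T : tables F) i mu,
    t_root T i != 0%R -> mu <= n ->
    within K (cache_init 0%R r T i mu)
      (fun c => c_idx c = i /\ c_mul c = mu).
Proof.
eexists=> F r T i mu root_neq0 le_mu; rewrite /cache_init.
bounded_step; first by bounded_step.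
bounded_step; first exact: bounded_signM.
bounded_step; last by apply: within_ret.
apply: (bounded_tabulate (N := n)) => [|j _]; first by rewrite size_iota; lia.
do 2!(bounded_step; first by bounded_step).
by apply: within_if => _; bounded_step.
Qed.

(** At most [n] caches are updated, and a new cache absorbs fewer than [n] earlier roots. The
    equation for [st'.1] lets the traversal track how many roots are assigned. *)
Lemma assign_within n : exists K,
  forall (F : fieldType) r (T : tables F) st b,
    good_tables n r.+1 T -> good_partial n r.+1 st ->
    (b.1 < r.+1) && (b.2 <= n) -> size st.1 < n ->
    within K (assign 0%R r T st b)
      (fun st' => good_partial n r.+1 st' /\ st'.1 = b :: st.1).
Proof.
have [K initP] := cache_init_within n.
eexists=> F r T [s cs] [i mu] [root_neq0 _ _ _] /and4P[/= s_ok cs_ok le_s le_cs].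
move=> /= imu_ok lt_s; have /andP[lt_i le_mu] := imu_ok; rewrite /assign.
apply: within_bind (_ : within (n * _) _ _) _.
  apply: (mapM_pred (D := good_cache n r.+1) (E := good_cache n r.+1)) => //=.
    exact: leq_trans le_cs le_s.
  move=> c /andP[lt_c le_c].
  apply: within_weaken (cache_update_within r T _ le_c) (leqnn _) _.
  by move=> c' [def_i def_m]; rewrite /good_cache def_i def_m lt_c.
move=> cs' [cs'_ok sz_cs'].
have {}sz_cs' : size cs' = size cs by [].
apply: within_if => _; last first.
  apply: within_ret; split=> //; apply/and4P; split=> //=.
    by rewrite imu_ok s_ok.
  by rewrite sz_cs' leqW.
apply: within_bind (initP _ _ _ _ _ (root_neq0 i lt_i) le_mu) _ => c0 c0P.
apply: within_bind (_ : within (n * _) _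
    (fun c => c_idx c = i /\ c_mul c = mu)) _.
  apply: within_foldM => // c b _ [def_i def_m].
  have le_c : c_mul c <= n by rewrite def_m.
  apply: within_weaken (cache_update_within r T b le_c) (leqnn _) _ => c'.
  by rewrite def_i def_m.
move=> c [def_i def_m]; apply: within_ret; split=> //; apply/and4P; split=> /=.
- by rewrite imu_ok s_ok.
- by rewrite /good_cache def_i def_m imu_ok.
- exact: lt_s.
by rewrite sz_cs'.
Qed.

Lemma f_coefs_bounded n : exists K, forall (F : fieldType) m (T : tables F) c,
  good_tables n m T -> c_mul c <= n -> bounded K (f_coefs 0%R 1%R T c).
Proof.
eexists=> F m T c [_ int_neq0 _ _] le_c.
apply: (bounded_tabrec (M := n)) => [|g [|j] lt_j]; last first.
- bounded_step; last by bounded_step => _; apply: int_neq0; lia.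
  apply: (bounded_sumM (N := n)) => [|i _]; first by rewrite size_iota; lia.
  by bounded_step.
- exact: within_retW.
lia.
Qed.

Lemma multM_bounded n : exists K, forall (F : fieldType) m (T : tables F) muls,
  good_tables n m T -> all (geq n) muls -> size muls <= n ->
  bounded K (multM 1%R n T muls).
Proof.
eexists=> F m T muls [_ _ fact_neq0 _] /allP le_muls sz_muls.
apply: within_bind (_ : within _ _ (fun d => d != 0%R)) _.
  apply: (prodM_neq0 (N := n)) => // mu /le_muls le_mu.
  by apply/within_ret/fact_neq0.
by move=> d d_neq0; bounded_step.
Qed.

(** The maximum of a nonempty list is attained. Together with [eta_le_size] this places [eta] among
    the invertible integers from 1 to [n]. *)
Lemma eta_gt0 muls : muls != [::] -> 0 < eta muls.
Proof.
move=> muls_neq0; rewrite /eta -has_count has_pred1.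
elim: muls muls_neq0 => // mu [|nu muls] IHmuls _.
  by rewrite /= maxn0 mem_head.
have {IHmuls} := IHmuls isT; move: (nu :: muls) => s /= s_max.
by rewrite inE; case: leqP => _; rewrite ?eqxx ?s_max ?orbT.
Qed.

Lemma eta_le_size muls : eta muls <= size muls.
Proof. exact: count_size. Qed.

Lemma evaluate_bounded n : exists K, forall (F : fieldType) m (T : tables F) st,
  good_tables n m T -> good_partial n m st -> st.1 != [::] ->
  bounded K (evaluate 0%R 1%R n T st).
Proof.
have [Kf f_coefsP] := f_coefs_bounded n; have [Km multMP] := multM_bounded n.
eexists=> F m T [s cs] good_T /and4P[/= /allP s_ok cs_ok le_s le_cs] s_neq0.
have [root_neq0 int_neq0 fact_neq0 _] := good_T.
pose good_pair := [pred cf : cache F * (nat -> F) | good_cache n m cf.1].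
have le_csn := leq_trans le_cs le_s; rewrite /evaluate; cbv zeta.
apply: within_bind.
  apply: (mapM_pred (E := good_pair)) cs_ok le_csn _ => c c_ok.
  have /andP[_ le_c] := c_ok.
  bounded_step; first exact: f_coefsP good_T le_c.
  exact: within_ret.
move=> cfs [cfs_ok sz_cfs]; rewrite -sz_cfs in le_csn.
bounded_step.
  by apply: sumM_pred cfs_ok le_csn _ => -[c f] _; bounded_step.
bounded_step.
  apply: sumM_pred cfs_ok le_csn _ => -[c f] /andP[lt_c le_c].
  rewrite /= in lt_c le_c.
  bounded_step; first by bounded_step => _; apply: root_neq0.
  bounded_step; last by bounded_step.
  apply: (bounded_sumM (N := n)) => [|j _]; first by rewrite size_iota; lia.
  by bounded_step => _; apply: fact_neq0; lia.
bounded_step.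
  apply: bounded_prodM le_s _ => b /s_ok/andP[_ le_b].
  exact: bounded_powM le_b.
bounded_step.
  apply: bounded_prodM le_s _ => b /s_ok/andP[_ le_b].
  do 2!(bounded_step; first by bounded_step).
  exact: bounded_powM le_b.
bounded_step; first by bounded_step.
bounded_step.
  apply: multMP good_T _ _; last by rewrite size_map.
  by rewrite all_map; apply/allP => b /s_ok/andP[].
bounded_step; first by bounded_step.
bounded_step => _; apply: int_neq0; rewrite eta_gt0 /=; last by case: (s) s_neq0.
by apply: leq_trans (eta_le_size _) _; rewrite size_map.
Qed.

Lemma candidatesP r done mu i : i \in candidates r done mu -> i < r.+1.
Proof.
case: done => [|[j nu] s]; first by rewrite inE => /eqP->.
by rewrite mem_filter mem_iota => /andP[].
Qed.

Lemma size_candidates r done mu : size (candidates r done mu) <= r.+1.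
Proof.
case: done => [|[j nu] s] //.
by rewrite size_filter (leq_trans (count_size _ _)) ?size_iota.
Qed.

(** The recursion tree has at most [m] children per node, so each of its [(size parts).+1] levels
    has at most [m ^ size parts] nodes, each of constant cost. *)
Lemma traverse_bounded n : exists K,
  forall (F : fieldType) r (T : tables F) parts st acc,
    good_tables n r.+1 T -> good_partial n r.+1 st -> st.1 != [::] ->
    all (geq n) parts -> size st.1 + size parts <= n ->
    bounded (K * (size parts).+1 * r.+1 ^ size parts)
      (traverse 0%R 1%R n r T parts st acc).
Proof.
have [Ka assignP] := assign_within n; have [Ke evaluateP] := evaluate_bounded n.
exists (Ka + (Ke + 1)) => F r T parts st acc good_T.
elim: parts st acc => [|mu parts IHparts] st acc st_ok st_neq0 /=.
  move=> _ _; rewrite !muln1.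
  apply: within_leq (leq_addl _ _).
  bounded_step; last by bounded_step.
  exact: evaluateP good_T st_ok st_neq0.
move=> /andP[le_mu le_parts] le_n.
set Y := r.+1 ^ size parts; have Y_gt0 : 0 < Y by rewrite expn_gt0.
apply: within_leq (_ : r.+1 * ((Ka + (Ke + 1)) * (size parts).+2 * Y) <= _);
  last by rewrite expnS mulnCA.
apply: within_foldM (size_candidates _ _ _) _ _ => // {}acc i /candidatesP lt_i _.
(* Since [Y >= 1], the cost [Ka] of one assignment is absorbed by the additional level. *)
apply: (within_leq (B := Ka + (Ka + (Ke + 1)) * (size parts).+1 * Y)); last by nia.
apply: within_bind.
  by apply: assignP; rewrite ?lt_i //; lia.
move=> st' [st'_ok def_st']; apply: IHparts => //; rewrite def_st' //=; lia.
Qed.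

Lemma partitions_ge2_all fuel mx n pat :
  pat \in partitions_ge2 fuel mx n -> all (leq 2) pat.
Proof.
elim: fuel mx n pat => [|fuel IHfuel] mx n pat; first by rewrite inE => /eqP->.
rewrite inE => /predU1P[-> //|/flatten_mapP[q]]; rewrite mem_iota => q_ge2.
by case/mapP=> l /IHfuel l_ge2 -> /=; rewrite l_ge2 andbT; lia.
Qed.

Lemma patternsP n m pat : pat \in patterns n m ->
  [/\ pat != [::], all (leq 2) pat, all (geq n) pat & sumn pat <= n].
Proof.
rewrite mem_filter => /andP[/andP[pat_neq0 /andP[le_n _]] pat_part].
have pat_ge2 := partitions_ge2_all pat_part.
split=> //; elim: pat le_n {pat_neq0 pat_part pat_ge2} => //= q pat IHpat le_n.
by rewrite IHpat ?andbT /=; lia.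
Qed.

(** The feasible patterns vary with [m]; the unfiltered list bounds their number by a constant
    depending on [n]. *)
Lemma size_patterns n m : size (patterns n m) <= size (partitions_ge2 n n n).
Proof. by rewrite size_filter count_size. Qed.

(* The patterns with sum of (part - 1) at most 2 are (2), (3) and (2,2). *)
Lemma notin_G0_size pat : pat != [::] -> all (leq 2) pat -> pat \notin G0 ->
  size pat + 3 <= sumn pat.
Proof.
have ge2 s : all (leq 2) s -> (size s).*2 <= sumn s.
  by elim: s => //= q s IHs /andP[q_ge2 /IHs]; lia.
case: pat => [//|a [|b s]] _.
  by case: a => [|[|[|[|a]]]] //=; lia.
move=> /and3P[a_ge2 b_ge2 s_ge2].
(* With three or more parts, twice their number is already at least their number plus 3. Two parts
   fail the inequality only for (2,2), which lies in [G0]. *)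
case: s s_ge2 => [_|c s s_ge2]; last by move: (ge2 (c :: s) s_ge2) => /=; lia.
have [->|a_neq2] := eqVneq a 2; last by move=> _ /=; lia.
have [->|b_neq2] := eqVneq b 2; last by move=> _ /=; lia.
by [].
Qed.

(** The first part has the root 1 as its only candidate and contributes no factor [m]; the
    hypothesis on the sum leaves at most [n - 4] parts to place after it. *)
Lemma traverse_pattern_bounded n : exists K,
  forall (F : fieldType) r (T : tables F) (pat : seq nat) acc,
    good_tables n r.+1 T -> pat != [::] -> all (geq n) pat ->
    size pat + 3 <= sumn pat <= n ->
    bounded (K * r.+1 ^ (n - 4))
      (traverse 0%R 1%R n r T (pat ++ nseq (n - sumn pat) 1) ([::], [::]) acc).
Proof.
have [Ka assignP] := assign_within n; have [Kt traverseP] := traverse_bounded n.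
exists (1 * (Ka + Kt * n)) => F r T [//|mu pat] acc good_T _.
move=> /andP[le_mu le_pat]; rewrite [size _]/= [sumn _]/= => sum_n.
rewrite -mulnA cat_cons; set rest := pat ++ _.
have sz_rest : size rest = size pat + (n - (mu + sumn pat)).
  by rewrite size_cat size_nseq.
apply: within_foldM => // {}acc i; rewrite inE => /eqP-> _.
apply: (within_leq (B := Ka + Kt * (size rest).+1 * r.+1 ^ size rest)).
  have n_gt0 : 0 < n by lia.
  have := assignP F r T ([::], [::]) (0, mu) good_T isT le_mu n_gt0.
  move/within_bind; apply=> st [st_ok def_st].
  apply: traverseP; rewrite ?def_st //=; last by rewrite sz_rest; lia.
  by rewrite all_cat (le_pat : all (geq n) pat) all_nseq /=; lia.
(* Both [(size rest).+1 <= n] and the exponent bound come from [size rest <= n - 4]. *)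
rewrite mulnDl leq_add // ?leq_pmulr ?expn_gt0 //.
apply: leq_mul; first by rewrite leq_mul2l; lia.
by rewrite leq_pexp2l //; lia.
Qed.

Lemma residual_sum_bounded n : exists K,
  forall (F : fieldType) r (T : tables F), good_tables n r.+1 T ->
    bounded (K * r.+1 ^ (n - 4)) (residual_sum 0%R 1%R n r T).
Proof.
have [K traverseP] := traverse_pattern_bounded n.
exists (size (partitions_ge2 n n n) * K) => F r T good_T.
rewrite -mulnA; apply: within_foldM => //.
  by rewrite size_filter (leq_trans (count_size _ _)) ?size_patterns.
move=> acc pat; rewrite mem_filter => /andP[notG0 pat_nm] _.
have [pat_neq0 ge2 le_n sum_n] := patternsP pat_nm.
by apply: traverseP; rewrite // notin_G0_size.
Qed.

(** * Class sums *)

Lemma mem_zip_snd (A B : eqType) (s : seq A) (t : seq B) x y :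
  (x, y) \in zip s t -> y \in t.
Proof.
elim: s t => [|a s IHs] [|b t] //=; rewrite !inE => /predU1P[[_ ->]|/IHs->].
  by rewrite eqxx.
by rewrite orbT.
Qed.

Lemma box_bounded n b g : all (geq n) b -> g \in box b ->
  all (geq n) g /\ size g = size b.
Proof.
elim: b g => [|x b IHb] g; first by rewrite inE => _ /eqP->.
case/andP=> le_x le_b /allpairsP[[i h] [i_x h_b ->]] /=.
have [-> ->] := IHb h le_b h_b; split=> //; rewrite andbT.
by rewrite mem_iota /= in i_x; rewrite /= in le_x; lia.
Qed.

Lemma size_box n b : all (geq n) b -> size (box b) <= n.+1 ^ size b.
Proof.
elim: b => [|x b IHb] // /andP[le_x /IHb le_b].
rewrite [box _]/box -/box.
by rewrite size_allpairs size_iota expnS leq_mul.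
Qed.

Lemma size_box_leq n d b :
  all (geq n) b -> size b <= d -> size (box b) <= n.+1 ^ d.
Proof.
move=> le_b le_d; apply: leq_trans (size_box le_b) _.
by rewrite leq_pexp2l.
Qed.

(** Truncated polynomials have at most [(n+1)^d] coefficients, so even the naive convolution has
    constant cost. *)
Lemma poly_mul_bounded n d : exists K, forall (F : fieldType) bd (P Q : _ -> F),
  all (geq n) bd -> size bd <= d -> bounded K (poly_mul 0%R bd P Q).
Proof.
eexists=> F bd P Q le_bd sz_bd.
apply: (bounded_tabulate (size_box_leq le_bd sz_bd)) => g g_bd.
have [le_g sz_g] := box_bounded le_bd g_bd.
apply: (bounded_sumM (N := n.+1 ^ d)) => [|u _].
  by apply: size_box_leq; rewrite ?sz_g.
by bounded_step.
Qed.

Lemma lincoef_bounded (F : fieldType) (T : tables F) pat R x i y :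
  bounded 1 (lincoef 0%R 1%R T pat R x i y).
Proof.
rewrite /lincoef; case: [seq q <- _ | _] => [|q _]; first exact: within_retW.
rewrite /Pcoef; case: ifP => _; case: i => [|[|i]] /=;
  by [exact: within_retW | bounded_step].
Qed.

Lemma lin_factor_bounded n d : exists K,
  forall (F : fieldType) (T : tables F) pat R bd x,
    all (geq n) bd -> size bd <= d ->
    bounded K (lin_factor 0%R 1%R T pat R bd x).
Proof.
eexists=> F T pat R bd x le_bd sz_bd.
apply: (bounded_tabulate (B := 1) (size_box_leq le_bd sz_bd)) => g _.
by case: g => [|[|?] [|i [|[|?] y]]];
  try exact: within_retW; apply: lincoef_bounded.
Qed.

Lemma P_R_bounded n d : exists K,
  forall (F : fieldType) (T : tables F) pat R bd,
    all (geq n) pat -> size pat <= n -> all (geq n) bd -> size bd <= d ->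
    bounded K (P_R 0%R 1%R T pat R bd).
Proof.
have [Km mulP] := poly_mul_bounded n d.
have [Kl linP] := lin_factor_bounded n d.
eexists=> F T pat R bd /allP le_pat sz_pat le_bd sz_bd; rewrite /P_R.
bounded_step.
  apply: (bounded_tabulate (size_box_leq le_bd sz_bd)) => g _.
  exact: within_ret.
apply: (within_foldM (N := n)) => [||P [b mu] /mem_zip_snd mu_pat _] //.
  by rewrite size_zip geq_min sz_pat orbT.
bounded_step; first exact: linP.
apply: (within_foldM (N := n)) => // [|P' i _ _].
  by rewrite size_iota; apply: le_pat.
exact: mulP.
Qed.

Lemma weight_bounded n : exists K, forall (F : fieldType) (T : tables F) R e s,
  all (geq n) e -> size e <= n -> bounded K (weight 1%R T R e s).
Proof.
eexists=> F T R e s /allP le_e sz_e; rewrite /weight.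
bounded_step; last by bounded_step.
apply: (bounded_prodM (N := n)) => [|[a ea] /mem_zip_snd/le_e le_ea].
  by rewrite size_zip geq_min sz_e orbT.
exact: (bounded_powM (N := n)).
Qed.

Lemma pass_factor_bounded n d : exists K,
  forall (F : fieldType) m (T : tables F) pat R e bd s,
    good_tables n m T -> all (geq n) e -> size e <= n ->
    all (geq n) bd -> size bd <= d ->
    bounded K (pass_factor 0%R 1%R T pat R e bd s).
Proof.
have [K weightP] := weight_bounded n.
eexists=> F m T pat R e bd s [_ _ fact_neq0 _] le_e sz_e le_bd sz_bd.
rewrite /pass_factor; bounded_step; first exact: weightP.
apply: (bounded_tabulate (B := 1 + (1 + (1 + 1))) (size_box_leq le_bd sz_bd)).
move=> g /(box_bounded le_bd)[le_g _].
case: g le_g => [|[|[|?]] [|i [|j y]]] le_g; try exact: within_retW.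
bounded_step; first exact: lincoef_bounded.
bounded_step; last by do 2?bounded_step.
bounded_step => _; apply: fact_neq0.
by case/and4P: le_g.
Qed.

Lemma L_op_bounded n : exists K,
  forall (F : fieldType) m (T : tables F) (c0 : F) D f,
    good_tables n m T -> D <= n -> bounded K (L_op 0%R 1%R T c0 D f).
Proof.
eexists=> F m T c0 D f [_ _ fact_neq0 _] le_D.
apply: (bounded_sumM (N := n.+1)) => [|i]; first by rewrite size_iota.
rewrite mem_iota => i_D.
apply: (bounded_sumM (N := n.+1)) => [|j _]; first by rewrite size_iota; lia.
bounded_step; first by bounded_step => _; apply: fact_neq0; lia.
bounded_step; first by apply: (bounded_powM (N := n)); lia.
do 2!(bounded_step; first by bounded_step).
exact: bounded_signM.
Qed.

(** Only the single pass over the elements outside [R] depends on [m]: at most [m] truncated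
    products, each of constant cost. *)
Lemma Psi_bounded n : 4 <= n -> exists K,
  forall (F : fieldType) r (T : tables F) pat R e (c0 : F),
    good_tables n r.+1 T -> all (geq n) pat -> size pat <= n ->
    all (geq n) e -> size e <= n ->
    bounded (K * r.+1) (Psi 0%R 1%R n r T pat R e c0).
Proof.
(* Three coordinates for [v], [Z], [z], then at most [n] for the variables [Y]. *)
move=> n_ge4; pose d := n.+3.
have [Km mulP] := poly_mul_bounded n d; have [Kp P_RP] := P_R_bounded n d.
have [Kf factorP] := pass_factor_bounded n d; have [Kl L_opP] := L_op_bounded n.
exists (Kp + (Kf + Km + Kl)) => F r T pat R e c0 good_T le_pat sz_pat le_e sz_e.
rewrite /Psi; set D := if _ then _ else _; cbv zeta.
have le_D : D <= n.
  by rewrite /D; case: ifP => // _; case: (e) le_e => //= ? ? /andP[].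
set bd := _ :: _.
have le_bd : all (geq n) bd by rewrite /= le_D leq_subr.
have sz_bd : size bd <= d by [].
apply: (within_leq (B := Kp + (r.+1 * (Kf + Km) + (Kl + 0)))); last by nia.
bounded_step; first exact: P_RP.
bounded_step.
  apply: within_foldM => // [|P s _ _].
    by rewrite size_filter (leq_trans (count_size _ _)) ?size_iota.
  by bounded_step; [apply: factorP good_T _ _ _ _ | apply: mulP].
by apply: within_if => _; [apply: L_opP good_T _ | apply: within_ret].
Qed.

(** Pascal's recursion with the crude estimate [N^k + N^(k+1) = (N+1) N^k <= (N+1)^(k+1)]. *)
Lemma size_sublists T k (s : seq T) : size (sublists k s) <= size s ^ k.
Proof.
elim: s k => [|x s IHs] [|k] //=.
rewrite size_cat size_map (leq_trans (leq_add (IHs k) (IHs k.+1))) //.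
rewrite expnS -mulSn expnS leq_mul //.
by case: k => // k; rewrite leq_exp2r.
Qed.

Lemma sublists_size (T : eqType) k (s l : seq T) :
  l \in sublists k s -> size l = k.
Proof.
elim: s k l => [|x s IHs] [|k] l; rewrite ?inE //; try by move/eqP->.
rewrite mem_cat => /orP[|/IHs //].
by case/mapP=> l' /IHs <- ->.
Qed.

Lemma within_scale (F : fieldType) A X B (c : prog F A) Q :
  0 < X -> within B c Q -> within (B * X) c Q.
Proof. by move=> X_gt0 /within_leq; apply; rewrite leq_pmulr. Qed.

Lemma bounded_bind_scaled (F : fieldType) A A' X K1 K2 (c : prog F A)
    (f : A -> prog F A') Q :
  bounded (K1 * X) c -> (forall a, within (K2 * X) (f a) Q) ->
  within ((K1 + K2) * X) (bind c f) Q.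
Proof. by rewrite mulnDl; apply: bounded_bind. Qed.

Lemma bounded_sumM_scaled (F : fieldType) (A : eqType) N K X (f : A -> prog F F)
    s x0 :
  0 < X -> size s <= N -> (forall a, a \in s -> bounded (K * X) (f a)) ->
  bounded (N * (K + 1) * X) (sumM x0 s f).
Proof.
move=> X_gt0 le_N fB; apply: within_leq (bounded_sumM x0 le_N fB) _.
by rewrite -mulnA leq_mul2l mulnDl leq_add2l mul1n X_gt0 orbT.
Qed.

Lemma qtilde_bounded n : exists K, forall (F : fieldType) (T : tables F) pat R q,
  all (geq n) pat -> size R <= n -> bounded K (qtilde 1%R n T pat R q).
Proof.
eexists=> F T pat R q /allP le_pat sz_R; rewrite /qtilde.
bounded_step; first by apply: (bounded_powM (N := n)); apply: leq_subr.
bounded_step; last by bounded_step.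
apply: (bounded_prodM (N := n)) => [|u _].
  by rewrite size_filter (leq_trans (count_size _ _)) ?size_iota.
apply: (bounded_powM (N := n)).
(* The lengths of [R] and [pat] are not related here; past the end of [pat] the default exponent is
   0. *)
have [/(mem_nth 0)/le_pat //|le_u] := ltnP u (size pat).
by rewrite nth_default.
Qed.

Lemma c0M_bounded n : 2 <= n -> exists K,
  forall (F : fieldType) r (T : tables F) R,
    good_tables n r.+1 T -> size R <= n -> bounded K (c0M 0%R n r T R).
Proof.
move=> n_ge2; eexists=> F r T R [_ int_neq0 _ _] sz_R; rewrite /c0M.
(* The divisor is 2, which lies between 1 and [n]. *)
bounded_step; first by bounded_step => _; apply: int_neq0.
bounded_step; last by do 2?bounded_step.
apply: (bounded_sumM (N := n)) => [|b _]; last exact: within_ret.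
by rewrite size_behead (leq_trans (leq_pred _)).
Qed.

(** The number of exponent vectors is at most [(n+1)^n], and each requires one evaluation of [Psi],
    which is linear in [m]. *)
Lemma class_term_bounded n : 4 <= n -> exists K,
  forall (F : fieldType) r (T : tables F) alt pat R,
    good_tables n r.+1 T -> pat != [::] -> all (geq n) pat -> size pat <= n ->
    size R <= n ->
    bounded (K * r.+1) (class_term 0%R 1%R n r alt T pat R).
Proof.
move=> n_ge4.
have [Kq qtildeP] := qtilde_bounded n.
have [Kc c0MP] := c0M_bounded (leq_trans (isT : 2 <= 4) n_ge4).
have [KPsi PsiP] := Psi_bounded n_ge4.
eexists=> F r T alt pat R good_T pat_neq0 le_pat sz_pat sz_R.
have [_ int_neq0 fact_neq0 _] := good_T.
rewrite /class_term.
apply: bounded_bind_scaled => [|num].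
  apply: within_scale => //; apply: (bounded_prodM (N := n)) => [|[a mu]].
    by rewrite size_zip geq_min sz_pat orbT.
  by move/mem_zip_snd/(allP le_pat); apply: bounded_powM.
apply: within_bind_scaled => [|den den_neq0].
  apply: within_scale => //; apply: (prodM_neq0 sz_pat) => mu mu_pat.
  by apply/within_ret/fact_neq0; apply: (allP le_pat).
apply: bounded_bind_scaled => [|pre].
  by apply: within_scale => //; bounded_step.
apply: bounded_bind_scaled => [|qt].
  apply: within_scale => //; apply: (bounded_tabulate (N := n)) => [|q _].
    by rewrite size_iota.
  exact: qtildeP.
apply: bounded_bind_scaled => [|c0].
  apply: within_scale => //; apply: within_if => _; last exact: within_ret.
  exact: c0MP.
apply: bounded_bind_scaled => [|s]; last first.
  by apply: within_scale => //; bounded_step.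
have le_nseq : all (geq n) (nseq (size pat) n) by rewrite all_nseq /= leqnn orbT.
apply: (bounded_sumM_scaled (N := n.+1 ^ n)) => // [|e].
  rewrite size_filter (leq_trans (count_size _ _)) //.
  by apply: size_box_leq; rewrite ?size_nseq.
rewrite mem_filter => /andP[_ /(box_bounded le_nseq)[le_e]].
rewrite size_nseq => sz_e.
apply: bounded_bind_scaled => [|Q].
  apply: within_scale => //; apply: (bounded_prodM (N := n)) => [|[q e_q]].
    by rewrite size_zip geq_min sz_e sz_pat orbT.
  by move/mem_zip_snd/(allP le_e); apply: bounded_powM.
apply: bounded_bind_scaled => [|psi]; first by apply: PsiP; rewrite ?sz_e.
apply: within_scale => //; bounded_step; first by bounded_step.
apply: within_if => _; last exact: within_ret.
bounded_step => _; apply: int_neq0.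
(* The vector [e] is as long as [pat], hence nonempty and of length at most [n]. *)
rewrite eta_gt0 -?size_eq0 ?sz_e ?size_eq0 //.
by rewrite (leq_trans (eta_le_size e)) ?sz_e.
Qed.

Lemma class_sum_bounded n : 4 <= n -> exists K,
  forall (F : fieldType) r (T : tables F) alt pat,
    good_tables n r.+1 T -> pat != [::] -> all (geq n) pat -> size pat <= 4 ->
    bounded (K * r.+1 ^ 4) (class_sum 0%R 1%R n r alt T pat).
Proof.
move=> n_ge4; have [K termP] := class_term_bounded n_ge4.
exists (K + 1 + 3) => F r T alt pat good_T pat_neq0 le_pat sz_pat.
have [_ int_neq0 _ _] := good_T.
have sz_pat_n := leq_trans sz_pat n_ge4.
(* As [R] contains 1 and has at most four elements, at most three are free, giving at most [m^3]
   sets. *)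
apply: (within_leq (B := r.+1 ^ 3 * (K * r.+1 + 1) + (1 + (1 + (0 + 1))))).
  rewrite /class_sum; bounded_step.
    apply: bounded_sumM => [|R].
      rewrite size_map (leq_trans (size_sublists _ _)) // size_iota.
      apply: leq_trans (_ : r.+1 ^ (size pat).-1 <= _).
        by case: (size pat).-1 => // k; rewrite leq_exp2r.
      by rewrite leq_pexp2l //; lia.
    case/mapP=> D /sublists_size sz_D ->; apply: termP => //=.
    by rewrite sz_D prednK // lt0n size_eq0.
  do 2!(bounded_step; first by bounded_step).
  apply: within_if => _; first exact: within_ret.
  bounded_step => _; apply: int_neq0.
  by rewrite eta_gt0 //= (leq_trans (eta_le_size pat)).
have : 0 < r.+1 ^ 3 by rewrite expn_gt0.
by rewrite [r.+1 ^ 4]expnS; nia.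
Qed.

Lemma class_sums_bounded n : 4 <= n -> exists K,
  forall (F : fieldType) r (T : tables F) alt, good_tables n r.+1 T ->
    bounded (K * r.+1 ^ 4) (class_sums 0%R 1%R n r alt T).
Proof.
move=> n_ge4; have [K class_sumP] := class_sum_bounded n_ge4.
eexists=> F r T alt good_T.
apply: (bounded_sumM_scaled (N := size (partitions_ge2 n n n))) => [||pat].
- by rewrite expn_gt0.
- by rewrite size_filter (leq_trans (count_size _ _)) ?size_patterns.
rewrite mem_filter => /andP[/andP[patG0 _] /patternsP[pat_neq0 _ le_pat _]].
apply: class_sumP => //.
(* That every pattern of [G0] has at most four parts is checked by computation. *)
by apply: (allP (_ : all (fun s => size s <= 4) G0)).
Qed.

(** * Total operation count *)

Theorem mainTheorem7 (n : nat) (hn : 4 <= n) :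
  exists K : nat,
    forall (r p : nat) (w : 'F_p) (alt : nat -> bool),
      1 <= r -> prime p -> 2 * n < p -> r.+1 %| p.-1 ->
      (r.+1.-primitive_root w)%R ->
      exists (v : 'F_p) (c : nat),
        run (world_cup 0%R 1%R w n r alt) = Some (v, c) /\
        c <= K * (r.+1 ^ (n - 4) + r.+1 ^ 4).
Proof.
have n_ge2 : 2 <= n by apply: leq_trans hn.
have [Kt tablesP] := make_tables_within n_ge2.
have [Kr residualP] := residual_sum_bounded n.
have [Kc classP] := class_sums_bounded hn.
(* The 2 accounts for the final division by [m^(n-1)] and the final addition. *)
exists (Kt + Kr + Kc + 2) => r p w alt r_ge1 p_pr p_gt m_dvd prim_w.
suff [[v c] run_wc [/= le_c _]] :
    bounded ((Kt + Kr + Kc + 2) * (r.+1 ^ (n - 4) + r.+1 ^ 4))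
      (world_cup 0%R 1%R w n r alt) by exists v, c.
have p_gt1 := prime_gt1 p_pr.
apply: (within_leq (B := Kt * r.+1 ^ 2 +
  (Kr * r.+1 ^ (n - 4) + (Kc * r.+1 ^ 4 + (1 + 1))))).
  rewrite /world_cup; apply: within_bind.
    apply: tablesP prim_w.
    - by move=> k k_n; apply: Fp_natr_neq0 => //; lia.
    (* As [m] divides [p - 1 > 0], it is smaller than [p] and thus nonzero mod [p]. *)
    apply: Fp_natr_neq0 => //; have := dvdn_leq _ m_dvd; lia.
  move=> T good_T; have [_ _ _ mpow_neq0] := good_T.
  bounded_step; first exact: residualP.
  bounded_step; first exact: classP.
  by do 2?bounded_step.
(* The cost of the tables is absorbed by the term for the class sums. *)
have : r.+1 ^ 2 <= r.+1 ^ 4 by rewrite leq_pexp2l.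
have : 0 < r.+1 ^ 4 by rewrite expn_gt0.
nia.
Qed.
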